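(* Let $n\in\mathbb{N}$, let $\hat D\subset\mathbb{C}^n$ be a set, and let $\mathcal{X}$ be a Banach space of complex-valued functions on $\hat D$ that satisfies Q1–Q3 over $\hat D$. Let $\Lambda\in\mathcal{X}^*$ be such that $\Lambda(e^{w\cdot z})\neq 0$ for every $w\in\mathbb{C}^n$. Then there exist $a\in\mathbb{C}\setminus\{0\}$ and $b\in\hat D$ such that $\Lambda(f)=a\cdot f(b)$ for every $f\in\mathcal{X}$.
   Context: $\mathcal{P}$ denotes the set of complex polynomials in $n$ variables, regarded as functions on $\hat D$. A Banach space $\mathcal{X}$ of complex-valued functions on a set $\hat D\subset\mathbb{C}^n$ satisfies Q1–Q3 over $\hat D$ if: (Q1) $\mathcal{P}$ is a dense subset of $\mathcal{X}$. (Q2) For every $z\in\hat D$ the point evaluation $\Lambda_z:\mathcal{X}\to\mathbb{C}$, $\Lambda_z f:=f(z)$, is a bounded linear functional on $\mathcal{X}$. Furthermore, if for some $z\in\mathbb{C}^n$ the map $p\mapsto p(z)$, $p\in\mathcal{P}$, extends to a bounded linear functional on all of $\mathcal{X}$, then $z\in\hat D$. (Q3) For every $1\le i\le n$ the shift operator $S_i:\mathcal{X}\to\mathcal{X}$, $(S_if)(z):=z_if(z)$, is a (well-defined) bounded linear operator. $e^{w\cdot z}$ denotes the function $z\mapsto \exp(\sum_{i=1}^n w_iz_i)$; under these assumptions it belongs to $\mathcal{X}$ for every $w\in\mathbb{C}^n$. $\mathcal{X}^*$ is the space of bounded linear functionals on $\mathcal{X}$. *)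

(* Defs.v *)
From HB Require Import structures.
From mathcomp Require Import all_boot all_order all_algebra.
From mathcomp Require Import complex.
From mathcomp Require Import all_classical all_reals all_analysis.
(* Not imported: the notations of mpoly clash with those of all_analysis. *)
From mathcomp Require mpoly.

Set Implicit Arguments.
Unset Strict Implicit.
Unset Printing Implicit Defensive.

Import Order.TTheory GRing.Theory Num.Theory.
Import numFieldNormedType.Exports.

Local Open Scope classical_set_scope.
Local Open Scope ring_scope.
Local Open Scope complex_scope.

Definition cexp (R : realType) (z : R[i]) : R[i] :=
  (expR (complex.Re z) * cos (complex.Im z))
    +i* (expR (complex.Re z) * sin (complex.Im z)).

Definition polyfun (R : realType) (n : nat) (p : mpoly.mpoly n R[i])
    (z : 'rV[R[i]]_n) : R[i] :=
  mpoly.meval (z ord0) p.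

(* z |-> exp (w_1 z_1 + ... + w_n z_n), without complex conjugation. *)
Definition expfun (R : realType) (n : nat) (w z : 'rV[R[i]]_n) : R[i] :=
  cexp (\sum_(i < n) w ord0 i * z ord0 i).

Definition bounded_operator (R : realType) (V W : normedModType R[i])
    (f : V -> W) : Prop :=
  exists M : R, forall x : V, `|f x| <= M%:C * `|x|.

(* A Banach space of complex-valued functions on D is given as a complete
   normed space X together with an injective linear map ev sending each element
   of X to the function on D that it is; vector operations are thus pointwise,
   and the norm is an arbitrary complete norm on a space of functions.
   D, used as a type, is the subtype of the points of the set D. *)
Definition Q1 (R : realType) (n : nat) (D : set 'rV[R[i]]_n)
    (X : completeNormedModType R[i]) (ev : {linear X -> (D -> R[i]^o)}) : Prop :=
  (forall p : mpoly.mpoly n R[i],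
     exists f : X, forall z : D, ev f z = polyfun p (val z)) /\
  dense [set f : X | exists p : mpoly.mpoly n R[i],
                       forall z : D, ev f z = polyfun p (val z)].

(* In the second part, the map p |-> p(z) is defined on polynomials regarded as
   elements of X: that L extends it includes that it does not depend on the
   choice of p representing a given f. *)
Definition Q2 (R : realType) (n : nat) (D : set 'rV[R[i]]_n)
    (X : completeNormedModType R[i]) (ev : {linear X -> (D -> R[i]^o)}) : Prop :=
  (forall z : D, bounded_operator (fun f : X => ev f z : R[i]^o)) /\
  (forall z : 'rV[R[i]]_n,
     (exists L : {linear X -> R[i]^o}, bounded_operator L /\
        forall (p : mpoly.mpoly n R[i]) (f : X),
          (forall x : D, ev f x = polyfun p (val x)) -> L f = polyfun p z) ->
     D z).

Definition Q3 (R : realType) (n : nat) (D : set 'rV[R[i]]_n)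
    (X : completeNormedModType R[i]) (ev : {linear X -> (D -> R[i]^o)}) : Prop :=
  forall i : 'I_n, exists S : {linear X -> X}, bounded_operator S /\
    forall (f : X) (z : D), ev (S f) z = (val z) ord0 i * ev f z.

(* Main.v *)
Require Import Defs.
From HB Require Import structures.
From mathcomp Require Import all_boot all_order all_algebra.
From mathcomp Require Import complex.
From mathcomp Require Import all_classical all_reals all_analysis.
From mathcomp Require Import -(notations) mpoly.
From mathcomp Require Import ring lra zify.

(** Write [l_w] for the linear form [z |-> \sum_i w_i z_i] and [L] for the
    functional. Since the shifts are bounded, [l_w ^ k] has norm at most
    [B * M ^ k] in [X], so the exponential series of [l_w] converges in [X], and
    its sum is [z |-> exp (w . z)] because evaluations are continuous. Hence
    [F t = L (exp (t w . z)) = \sum_k L (l_w ^ k) t ^ k / k!] is an entire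
    function of exponential type, without zeros by hypothesis. Such a function is
    [F 0 * exp (c t)], so that [L (l_w ^ k) = a * c ^ k] with [a = L 1] and
    [c = L l_w / a]. As [c] is linear in [w], it equals [l_w b] for the point [b]
    with coordinates [L z_i / a]: thus [L p = a * p b] for the powers of linear
    forms, by polarization for all polynomials [p], and by density for all
    elements of [X]; the maximality condition in [Q2] places [b] in [D].

    The fact on entire functions is a case of Hadamard's factorization theorem
    ([nonvanishing_recurrence]). It is obtained here from the Taylor polynomials
    [p_N] of [F / F 0], written as [\prod_j (1 + x_j t)]. The [-1 / x_j] are the
    zeros of [p_N]; since [F] has no zeros they leave every disc as [N] grows
    ([near_no_root], by compactness). Landau's inequality ([landau_ineq]) bounds
    the product of any of the [|r x_j|] by the [l^2] norm of the coefficients of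
    [p_N (r t)], which exponential type bounds by [C * exp (A r)]; with the [x_j]
    in decreasing order of modulus, applying it to the first [j] of them and
    [r = j] gives [|x_j| <= K / j] with [K] independent of [N] ([root_decay]).
    Both facts together make [\sum_j |x_j| ^ 2] tend to zero. Now
    [p_N' = (\sum_j x_j) p_N - t \sum_j x_j ^ 2 \prod_(i <> j) (1 + x_i t)], and
    the coefficients of the last products are bounded by those of [p_N]
    ([newton_defect]). In the limit the Taylor coefficients [a_k] satisfy
    [(k + 1) a_(k + 1) = a_1 a_k], the recurrence of an exponential. *)

Set Implicit Arguments.
Unset Strict Implicit.
Unset Printing Implicit Defensive.

Import Order.TTheory GRing.Theory Num.Theory.
Import numFieldNormedType.Exports.
Import ComplexField.Normc.

Local Open Scope classical_set_scope.
Local Open Scope ring_scope.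

(** * Products of linear factors and Landau's inequality *)

(** Factors are normalized by their constant coefficient rather than by their
    leading one: the entries of [xs] are the opposites of the inverses of the
    roots, the quantities that are small when the roots are far away. *)
Definition linprod (C : nzRingType) (xs : seq C) : {poly C} :=
  \prod_(x <- xs) (1 + x *: 'X).

Lemma coef_1DZX_mul (C : comNzRingType) (y : C) (q : {poly C}) i :
  ((1 + y *: 'X) * q)`_i = q`_i + (if i is j.+1 then y * q`_j else 0).
Proof.
rewrite mulrDl mul1r -scalerAl coefD coefZ coefXM.
by case: i => [|i] //=; rewrite mulr0.
Qed.

Lemma coef_polyCDX_mul (C : comNzRingType) (y : C) (q : {poly C}) i :
  ((y%:P + 'X) * q)`_i = y * q`_i + (if i is j.+1 then q`_j else 0).
Proof. by rewrite mulrDl coefD coefCM coefXM; case: i. Qed.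

Lemma coef0_linprod (C : comNzRingType) (xs : seq C) : (linprod xs)`_0 = 1.
Proof.
rewrite /linprod; elim: xs => [|x xs IH]; first by rewrite big_nil coef1.
by rewrite big_cons coef_1DZX_mul IH addr0.
Qed.

Lemma coef_linprod_scale (C : comNzRingType) (r : C) (xs : seq C) k :
  (linprod [seq r * x | x <- xs])`_k = r ^+ k * (linprod xs)`_k.
Proof.
rewrite /linprod; elim: xs k => [|x xs IH] k /=.
  by rewrite !big_nil coef1; case: k => [|k]; rewrite ?mulr1 // mulr0.
rewrite !big_cons !coef_1DZX_mul IH; case: k => [|k]; first by rewrite !addr0.
by rewrite IH exprS; ring.
Qed.

Lemma size_linprod (C : idomainType) (xs : seq C) :
  (size (linprod xs) <= (size xs).+1)%N.
Proof.
rewrite /linprod; elim: xs => [|x xs IH]; first by rewrite big_nil size_poly1.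
have sx : (size (1 + x *: 'X : {poly C})%R <= 2)%N.
  apply: leq_trans (size_polyD _ _) _; rewrite geq_max size_poly1 /=.
  by apply: leq_trans (size_scale_leq _ _) _; rewrite size_polyX.
rewrite big_cons; apply: leq_trans (size_polyMleq _ _) _.
by rewrite -subn1 leq_subLR; apply: (leq_add sx IH).
Qed.

(** The root [- y^-1] is reflected in the unit circle. On the circle the factors
    [1 + y z] and [y^* + z] have the same modulus, so by Parseval's identity the
    two products have the same [l^2] norm; algebraically, the difference of the
    squared moduli of the coefficients telescopes. *)
Lemma l2norm_flip (C : numClosedFieldType) (y : C) (q : {poly C}) N :
  (size q <= N)%N ->
  \sum_(i < N.+1) `|((1 + y *: 'X) * q)`_i| ^+ 2
  = \sum_(i < N.+1) `|((y^* %:P + 'X) * q)`_i| ^+ 2.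
Proof.
move=> sq; apply/eqP; rewrite -subr_eq0 -sumrB big_ord_recl /=.
pose u i := `|q`_i| ^+ 2.
rewrite (eq_bigr (fun i : 'I_N => (1 - y * y^* ) * (u i.+1 - u i))); last first.
  move=> i _; rewrite coef_1DZX_mul coef_polyCDX_mul /u /bump /= add1n.
  by rewrite !normCK !rmorphD !rmorphM /= conjCK; ring.
rewrite -mulr_sumr -(big_mkord predT (fun i => u i.+1 - u i)).
rewrite telescope_sumr // {1}/u [q`_N]nth_default // normr0 expr0n /=.
rewrite coef_1DZX_mul coef_polyCDX_mul !addr0 /u !normCK rmorphM /= conjCK.
by apply/eqP; ring.
Qed.

(** Flipping every factor of [linprod xs] keeps the [l^2] norm and turns the
    constant coefficient of the product into [q`_0 * \prod_(x <- xs) x^*]. *)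
Lemma landau_ineq (C : numClosedFieldType) (xs : seq C) (q : {poly C}) N :
  (size q + size xs <= N.+1)%N ->
  `|q`_0| ^+ 2 * \prod_(x <- xs) `|x| ^+ 2
  <= \sum_(i < N.+1) `|(q * linprod xs)`_i| ^+ 2.
Proof.
rewrite /linprod.
elim: xs q => [|x xs IH] q /= sz.
  rewrite !big_nil !mulr1 big_ord_recl lerDl.
  by apply: sumr_ge0 => i _; rewrite exprn_ge0.
rewrite !big_cons [q * _]mulrCA l2norm_flip; last first.
  apply: leq_trans (size_polyMleq _ _) _; rewrite -subn1 leq_subLR.
  exact: leq_trans (leq_add (leqnn _) (size_linprod xs)) sz.
rewrite [_ * (q * _)]mulrA; apply: le_trans (IH _ _); last first.
  apply: leq_trans sz; rewrite addnS -addSn leq_add2r.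
  apply: leq_trans (size_polyMleq _ _) _.
  by rewrite addrC size_XaddC.
rewrite coef_polyCDX_mul addr0 normrM norm_conjC exprMn mulrA.
by rewrite [_ * `|x| ^+ 2]mulrC.
Qed.

(** * The derivative of a product of linear factors *)

Lemma deriv_prod (C : comNzRingType) (I : eqType) (r : seq I)
    (F : I -> {poly C}) :
  uniq r ->
  (\prod_(i <- r) F i)^`()
  = \sum_(j <- r) (F j)^`() * \prod_(i <- r | i != j) F i.
Proof.
elim: r => [|a r IH] /=; first by rewrite !big_nil -polyC1 derivC.
case/andP=> ar ur; rewrite !big_cons derivM IH // eqxx /=; congr (_ + _).
  congr (_ * _); rewrite big_seq [RHS]big_seq_cond; apply: eq_bigl => i.
  by case: eqP => [->|_]; rewrite ?andbT // (negbTE ar).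
rewrite mulr_sumr !big_seq; apply: eq_bigr => j jr.
rewrite big_cons; case: eqP => [e|_]; first by rewrite e jr in ar.
by rewrite mulrCA.
Qed.

(** With [p = (1 + x j *: 'X) * q j], each summand [x j *: q j] of the derivative
    equals [x j *: p - x j ^+ 2 *: ('X * q j)], and the sum of the [x j] is the
    coefficient [p`_1]. *)
Lemma coef_deriv_linprod (C : comNzRingType) (n : nat) (x : 'I_n -> C) k
    (p := \prod_i (1 + x i *: 'X))
    (q := fun j => \prod_(i | i != j) (1 + x i *: 'X)) :
  p`_k.+2 *+ k.+2 = p`_1 * p`_k.+1 - \sum_j x j ^+ 2 * (q j)`_k.
Proof.
have pE j : p = (1 + x j *: 'X) * q j by rewrite /p (bigD1 j).
have qE j i : (q j)`_i.+1 = p`_i.+1 - x j * (q j)`_i.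
  by rewrite (pE j) coef_1DZX_mul addrK.
have q0 j : (q j)`_0 = 1.
  rewrite -horner_coef0 /q horner_prod big1 // => i _.
  by rewrite !hornerE.
have p' : p^`() = \sum_j x j *: q j.
  rewrite /p deriv_prod ?index_enum_uniq //; apply: eq_bigr => j _.
  by rewrite derivD derivZ derivX -polyC1 derivC add0r -scalerAl mul1r.
have p1 : p`_1 = \sum_j x j.
  have := coef_deriv p 0; rewrite mulr1n => <-.
  rewrite p' coef_sum; apply: eq_bigr => j _.
  by rewrite coefZ q0 mulr1.
rewrite -coef_deriv p' coef_sum p1 mulr_suml -sumrB.
by apply: eq_bigr => j _; rewrite coefZ qE; ring.
Qed.

Lemma coef_linear_cofactor_le (C : numDomainType) (x : C) (p q : {poly C}) k :
  p = (1 + x *: 'X) * q -> `|x| <= 1 ->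
  `|q`_k| <= \sum_(i < k.+1) `|p`_i|.
Proof.
move=> pE x1; elim: k => [|k IH].
  by rewrite big_ord1 pE coef_1DZX_mul addr0.
have -> : q`_k.+1 = p`_k.+1 - x * q`_k by rewrite pE coef_1DZX_mul addrK.
rewrite big_ord_recr /= addrC; apply: le_trans (ler_normB _ _) _.
rewrite lerD2l normrM; apply: le_trans IH.
by rewrite ler_piMl.
Qed.

(** For the coefficients of an exponential, the left-hand side would vanish. The
    bound involves the number of factors only through the sum of the squares
    [`|x i| ^+ 2]. *)
Lemma newton_defect (C : numDomainType) (n : nat) (x : 'I_n -> C) k
    (p := \prod_i (1 + x i *: 'X)) :
  (forall i, `|x i| <= 1) ->
  `|p`_k.+2 *+ k.+2 - p`_1 * p`_k.+1|
  <= (\sum_i `|x i| ^+ 2) * \sum_(i < k.+1) `|p`_i|.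
Proof.
move=> x1; rewrite /p coef_deriv_linprod -/p addrAC subrr add0r normrN.
rewrite mulr_suml.
apply: le_trans (ler_norm_sum _ _ _) _; apply: ler_sum => j _.
rewrite normrM normrX; apply: ler_wpM2l; first by rewrite exprn_ge0.
by apply: (@coef_linear_cofactor_le _ (x j)) => //; rewrite /p (bigD1 j).
Qed.

Lemma linprod_factor (F : closedFieldType) (p : {poly F}) :
  p`_0 = 1 ->
  exists2 xs : seq F, p = linprod xs &
    forall x, x \in xs -> x != 0 /\ p.[- x^-1] = 0.
Proof.
move=> p0; have [r pE] := closed_field_poly_normal p.
have p00 : p.[0] = lead_coef p * \prod_(z <- r) (- z).
  rewrite pE hornerZ horner_prod; congr (_ * _).
    by rewrite -pE.
  by apply: eq_bigr => z _; rewrite hornerXsubC sub0r.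
have r0 z : z \in r -> z != 0.
  move=> zr; apply/eqP => z0.
  have := p00; rewrite horner_coef0 p0 (big_rem z) //=.
  by rewrite z0 oppr0 mul0r mulr0 => /eqP; rewrite oner_eq0.
exists [seq - z^-1 | z <- r].
  rewrite /linprod big_map.
  rewrite (_ : \prod_(z <- r) _ = \prod_(z <- r) ((- z)^-1 *: ('X - z%:P))).
    rewrite scaler_prod prodfV.
    have := p00; rewrite horner_coef0 p0 => e.
    have : \prod_(z <- r) - z != 0.
      by apply/eqP => h; move/eqP: e; rewrite h mulr0 oner_eq0.
    by move=> nz; rewrite -[X in X *: _]mul1r {1}e mulfK.
  rewrite big_seq [RHS]big_seq; apply: eq_bigr => z /r0 z0.
  rewrite invrN scalerBr -[(- z^-1) *: z%:P]mul_polyC -polyCM mulNr mulVf //.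
  by rewrite polyCN opprK addrC.
move=> x /mapP [z zr ->]; rewrite oppr_eq0 invr_eq0 (r0 _ zr); split=> //.
rewrite invrN opprK invrK pE hornerZ horner_prod (big_rem z) //=.
by rewrite hornerXsubC subrr mul0r mulr0.
Qed.

(** * The real-valued modulus *)

Local Open Scope complex_scope.

Lemma normr_normc (R : realType) (z : R[i]) : `|z| = (normc z)%:C.
Proof. by []. Qed.

Lemma normc_ge0 (R : realType) (z : R[i]) : 0 <= normc z.
Proof. by rewrite -ler0c -normr_normc. Qed.

Lemma normc_eq0 (R : realType) (z : R[i]) : (normc z == 0) = (z == 0).
Proof. by rewrite -(inj_eq (@complexI R)) -normr_normc normr_eq0. Qed.

Lemma normc_le (R : realType) (z : R[i]) (r : R) :
  (normc z <= r) = (`|z| <= r%:C).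
Proof. by rewrite normr_normc lecR. Qed.

Lemma normc_sum (R : realType) (I : Type) (r : seq I) (P : pred I)
    (F : I -> R[i]) :
  normc (\sum_(i <- r | P i) F i) <= \sum_(i <- r | P i) normc (F i).
Proof. rewrite -lecR -normr_normc rmorph_sum; exact: ler_norm_sum. Qed.

Lemma normcX (R : realType) (z : R[i]) k : normc (z ^+ k) = normc z ^+ k.
Proof. by apply: complexI; rewrite rmorphXn -!normr_normc normrX. Qed.

Lemma normc_distC (R : realType) (x y : R[i]) : normc (x - y) = normc (y - x).
Proof. by apply: complexI; rewrite -!normr_normc distrC. Qed.

Lemma normc_real (R : realType) (r : R) : normc r%:C = `|r|.
Proof. by rewrite /= expr0n /= addr0 sqrtr_sqr. Qed.

Lemma normc_le_abs (R : realType) (x y : R) : normc (x +i* y) <= `|x| + `|y|.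
Proof.
rewrite -[leRHS]ger0_norm ?addr_ge0 // -sqrtr_sqr ler_sqrt ?sqr_ge0 //=.
rewrite sqrrD !real_normK ?num_real // lerD2r lerDl.
by rewrite mulrn_wge0 // mulr_ge0.
Qed.

Lemma normc_ge_abs (R : realType) (x y : R) :
  (`|x| <= normc (x +i* y)) && (`|y| <= normc (x +i* y)).
Proof.
by rewrite -!sqrtr_sqr !ler_sqrt ?addr_ge0 ?sqr_ge0 // lerDl lerDr !sqr_ge0.
Qed.

Lemma posC_real (R : realType) (e : R[i]) :
  0 < e -> exists2 r : R, 0 < r & e = r%:C.
Proof. by case: e => x y; rewrite ltcE /= => /andP[/eqP -> x0]; exists x. Qed.

Lemma eq0_of_normc_le (R : realType) (z : R[i]) (K : R) :
  0 <= K -> (forall e : R, 0 < e -> normc z <= K * e) -> z = 0.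
Proof.
move=> K0 h; apply/eqP; rewrite -normc_eq0 eq_le normc_ge0 andbT leNgt.
apply/negP => z0.
have K1 : 0 < 2 * (K + 1) by rewrite mulr_gt0 // ltr_wpDl.
have := h _ (divr_gt0 z0 K1); rewrite mulrA ler_pdivlMr //.
by nra.
Qed.

(** * Partial sums of the exponential series *)

Definition exp_sum {F : fieldType} (N : nat) (x : F) : F :=
  \sum_(k < N) x ^+ k / k`!%:R.

Lemma exp_sum_le (R : realType) N (x : R) : 0 <= x -> exp_sum N x <= expR x.
Proof.
move=> x0; rewrite /exp_sum -(big_mkord predT (fun k => x ^+ k / k`!%:R)).
apply: (nondecreasing_cvgn_le _ (is_cvg_series_exp_coeff x)).
by apply: nondecreasing_series => k _ _; apply: exp_coeff_ge0.
Qed.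

Lemma exp_sum_cvg (R : realType) (x : R) :
  exp_sum n x @[n --> \oo] --> expR x.
Proof.
have -> : (fun n => exp_sum n x) = series (exp_coeff x).
  by apply/funext => n; rewrite /exp_sum /series /= big_mkord.
exact: is_cvg_series_exp_coeff.
Qed.

(** The difference on the left is the sum of the terms
    [a ^ i / i! * (b ^ j / j!)] with [i, j < N <= i + j], and the right-hand side
    is the same sum for [`|a|] and [`|b|]. The truncated series are encoded as
    polynomials, whose product has these terms as its coefficients of index at
    least [N]. *)
Lemma norm_exp_sumM_sub (F : numFieldType) N (a b : F) :
  `|exp_sum N a * exp_sum N b - exp_sum N (a + b)|
  <= exp_sum N `|a| * exp_sum N `|b| - exp_sum N (`|a| + `|b|).
Proof.
pose P x : {poly F} := \poly_(i < N) (x ^+ i / i`!%:R).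
have PE x : exp_sum N x = (P x).[1].
  by rewrite horner_poly; apply: eq_bigr => i _; rewrite expr1n mulr1.
have sP x y : (size (P x * P y)%R <= N + N)%N.
  apply: leq_trans (size_polyMleq _ _) _; apply: leq_trans (leq_pred _) _.
  by apply: leq_add; apply: size_poly.
have PM x y k : (k < N)%N -> (P x * P y)`_k = (x + y) ^+ k / k`!%:R.
  move=> kN; rewrite coefM addrC exprDn mulr_suml; apply: eq_bigr => i _.
  have ik : (i <= k)%N by rewrite -ltnS.
  rewrite !coef_poly (leq_ltn_trans ik kN) (leq_ltn_trans (leq_subr _ _) kN).
  have := bin_fact ik => /(congr1 (fun n => n%:R : F)); rewrite !natrM => <-.
  have nz m : m`!%:R != 0 :> F by rewrite pnatr_eq0 -lt0n fact_gt0.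
  by rewrite -mulr_natr; field; rewrite !nz pnatr_eq0 -lt0n bin_gt0.
have ME x y : exp_sum N x * exp_sum N y - exp_sum N (x + y)
    = \sum_(i < N) (P x * P y)`_(N + i).
  pose e (k : 'I_N) : F := (x + y) ^+ k / k`!%:R.
  rewrite !PE -hornerM (horner_coef_wide _ (sP x y)) big_split_ord /=.
  rewrite horner_poly addrAC (eq_bigr e); last first.
    by move=> k _; rewrite expr1n mulr1 PM.
  rewrite [X in _ + X](eq_bigr (fun i : 'I_N => (P x * P y)`_(N + i))).
    rewrite [X in _ - X](eq_bigr e) ?subrr ?add0r // => i _.
    by rewrite expr1n mulr1.
  by move=> i _; rewrite expr1n mulr1.
rewrite !ME; apply: le_trans (ler_norm_sum _ _ _) _; apply: ler_sum => i _.
rewrite !coefM; apply: le_trans (ler_norm_sum _ _ _) _; apply: ler_sum => j _.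
rewrite normrM !coef_poly; case: ifP; case: ifP;
  by rewrite ?normr0 ?mul0r ?mulr0 // !normrM !normfV !normrX !normr_nat.
Qed.

Lemma exp_sum_imag (R : realType) N (y : R) :
  exp_sum N (0 +i* y) = series (cos_coeff y) N +i* series (sin_coeff y) N.
Proof.
rewrite /exp_sum /series /= !big_mkord.
elim: N => [|N IH]; first by rewrite !big_ord0.
rewrite !big_ord_recr /= IH.
suff -> : (0 +i* y) ^+ N / N`!%:R = cos_coeff y N +i* sin_coeff y N by [].
have -> : (N`!%:R : R[i])^-1 = (N`!%:R^-1 : R)%:C.
  by rewrite fmorphV rmorph_nat.
have iE m : (0 +i* y) ^+ m.*2 = ((-1) ^+ m * y ^+ m.*2)%:C.
  rewrite -mul2n exprM [(_ +i* _) ^+ 2](_ : _ = (- (y ^+ 2))%:C); last first.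
    rewrite expr2; apply/eqP; rewrite eq_complex /=.
    by apply/andP; split; apply/eqP; ring.
  by rewrite exprM -exprMn mulN1r rmorphXn.
rewrite /cos_coeff /sin_coeff /= -[in (0 +i* y) ^+ N](odd_double_half N).
case: (boolP (odd N)) => oN /=.
  rewrite add1n exprS iE; apply/eqP; rewrite eq_complex /= -exprnP.
  have -> : N.-1./2 = N./2 by rewrite -[in LHS](odd_double_half N) oN /= doubleK.
  rewrite -[in y ^+ N](odd_double_half N) oN add1n exprS.
  by apply/andP; split; apply/eqP; ring.
rewrite add0n iE; apply/eqP; rewrite eq_complex /= -exprnP.
rewrite -[in y ^+ N](odd_double_half N) (negbTE oN) add0n.
by apply/andP; split; apply/eqP; ring.
Qed.

(** At [x +i* y] the partial sum is close to the product of those at [x] and at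
    [0 +i* y], with an error that tends to [e^|x| e^|y| - e^(|x| + |y|) = 0]; the
    two factors converge by the series that define [expR], [cos] and [sin]. *)
Lemma exp_sum_cvg_cexp (R : realType) (z : R[i]) :
  normc (exp_sum n z - cexp z) @[n --> \oo] --> (0 : R).
Proof.
case: z => x y.
pose E := cos y +i* sin y.
have zE : x +i* y = x%:C + (0 +i* y).
  by apply/eqP; rewrite eq_complex /= addr0 add0r !eqxx.
have ceE : cexp (x +i* y) = (expR x)%:C * E.
  by apply/eqP; rewrite eq_complex /=; apply/andP; split; apply/eqP; ring.
pose na := normc x%:C. pose nb := normc (0 +i* y).
pose d n := (exp_sum n na * exp_sum n nb - exp_sum n (na + nb))
  + (`|exp_sum n x| * (`|series (cos_coeff y) n - cos y|
                       + `|series (sin_coeff y) n - sin y|)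
     + `|exp_sum n x - expR x| * normc E).
have d0 : d n @[n --> \oo] --> (0 : R).
  have -> : 0 = (expR na * expR nb - expR (na + nb))
      + (`|expR x| * (`|cos y - cos y| + `|sin y - sin y|)
         + `|expR x - expR x| * normc E).
    by rewrite expRD !subrr normr0 addr0 mulr0 mul0r !addr0.
  have cc : series (cos_coeff y) n @[n --> \oo] --> cos y.
    by rewrite unlock; exact: is_cvg_series_cos_coeff.
  have cs : series (sin_coeff y) n @[n --> \oo] --> sin y.
    by rewrite unlock; exact: is_cvg_series_sin_coeff.
  apply: cvgD; first by apply: cvgB; [apply: cvgM|]; exact: exp_sum_cvg.
  apply: cvgD.
    apply: cvgM; first by apply: cvg_norm; exact: exp_sum_cvg.
    by apply: cvgD; apply: cvg_norm; apply: cvgB => //; exact: cvg_cst.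
  apply: cvgM; last exact: cvg_cst.
  by apply: cvg_norm; apply: cvgB; [exact: exp_sum_cvg|exact: cvg_cst].
apply: (squeeze_cvgr _ (cvg_cst 0) d0); near=> n.
apply/andP; split; first exact: normc_ge0.
rewrite ceE zE.
have expC m (t : R) : exp_sum m t%:C = (exp_sum m t)%:C.
  rewrite /exp_sum rmorph_sum; apply: eq_bigr => k _.
  by rewrite rmorphM fmorphV rmorph_nat rmorphXn.
rewrite -(subrKA (exp_sum n x%:C * exp_sum n (0 +i* y))).
apply: le_trans (le_normcD _ _) _; rewrite /d; apply: lerD.
  rewrite normc_distC normc_le; apply: le_trans (norm_exp_sumM_sub _ _ _) _.
  by rewrite !normr_normc -rmorphD !expC -rmorphM -rmorphB.
rewrite exp_sum_imag expC.
set u := series _ n; set v := series _ n; set w := exp_sum n x.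
have -> : w%:C * (u +i* v) - (expR x)%:C * E
    = w%:C * ((u - cos y) +i* (v - sin y)) + (w - expR x)%:C * E.
  by apply/eqP; rewrite eq_complex /=; apply/andP; split; apply/eqP; ring.
apply: le_trans (le_normcD _ _) _; rewrite !normcM !normc_real.
by rewrite lerD2r ler_wpM2l // normc_le_abs.
Unshelve. all: by end_near.
Qed.

(** * Entire functions of exponential type without zeros *)

Lemma sum_sqr_le_sqr_sum (R : realDomainType) (n : nat) (v : nat -> R) :
  (forall i, 0 <= v i) -> \sum_(i < n) v i ^+ 2 <= (\sum_(i < n) v i) ^+ 2.
Proof.
move=> v0; elim: n => [|n IH]; first by rewrite !big_ord0 expr0n.
rewrite !big_ord_recr /=; have := v0 n.
have : 0 <= \sum_(i < n) v i by apply: sumr_ge0.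
by nra.
Qed.

(** Landau's inequality for the [j.+1] factors of largest [normc], after scaling
    by [m = j.+1]: all of them have modulus at least [s = normc xs`_j], so
    [(m s) ^ m <= C e^(A m)]. *)
Lemma root_decay (R : realType) (xs : seq R[i]) (C A : R) (j : nat) :
  0 <= A ->
  (forall k, normc (linprod xs)`_k <= C * (A ^+ k / k`!%:R)) ->
  sorted (fun x y => normc y <= normc x) xs ->
  (j < size xs)%N ->
  j.+1%:R * normc xs`_j <= C * expR A.
Proof.
move=> A0 bound srt jx; pose m := j.+1.
have C1 : 1 <= C.
  by have := bound 0; rewrite coef0_linprod normc1 expr0 divr1 mulr1.
have C0 : 0 <= C by apply: le_trans C1.
pose f (x : R[i]) := m%:R * x.
set s := normc xs`_j.
have fE : linprod (map f xs)
    = linprod (map f (drop m xs)) * linprod (map f (take m xs)).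
  by rewrite -{1}(cat_take_drop m xs) map_cat /linprod big_cat mulrC.
have := @landau_ineq R[i] (map f (take m xs)) (linprod (map f (drop m xs))) _
  (leqnSn _).
set N := (_ + _)%N; rewrite -fE coef0_linprod normr1 expr1n mul1r big_map.
have -> : \prod_(x <- take m xs) `|f x| ^+ 2
    = ((\prod_(x <- take m xs) (m%:R * normc x)) ^+ 2)%:C.
  rewrite -prodrXl rmorph_prod; apply: eq_bigr => x _.
  rewrite /f normrM normr_nat normr_normc -(rmorph_nat (real_complex R)).
  by rewrite -rmorphM -rmorphXn.
have -> : \sum_(i < N.+1) `|(linprod (map f xs))`_i| ^+ 2
   = (\sum_(i < N.+1) (m%:R ^+ i * normc (linprod xs)`_i) ^+ 2)%:C.
  rewrite rmorph_sum; apply: eq_bigr => i _.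
  rewrite /f coef_linprod_scale normrM normrX normr_nat normr_normc.
  by rewrite -(rmorph_nat (real_complex R)) -rmorphXn -rmorphM -rmorphXn.
rewrite lecR => h.
have {}h : (m%:R * s) ^+ m <= C * expR (m%:R * A).
  have {h} : (\prod_(x <- take m xs) (m%:R * normc x)) ^+ 2
      <= (C * expR (m%:R * A)) ^+ 2.
    apply: le_trans h _.
    pose v i := m%:R ^+ i * normc (linprod xs)`_i.
    have v0 i : 0 <= v i by rewrite mulr_ge0 ?exprn_ge0 ?normc_ge0.
    apply: le_trans (sum_sqr_le_sqr_sum _ v0) _.
    rewrite ler_sqr ?nnegrE ?mulr_ge0 ?expR_ge0 //; last by apply: sumr_ge0.
    apply: le_trans (_ : C * exp_sum N.+1 (m%:R * A) <= _); last first.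
      by rewrite ler_wpM2l // exp_sum_le // mulr_ge0.
    rewrite /exp_sum mulr_sumr; apply: ler_sum => i _.
    apply: le_trans (ler_wpM2l _ (bound i)) _; first by rewrite exprn_ge0.
    by rewrite exprMn mulrCA !mulrA.
  rewrite ler_sqr ?nnegrE ?mulr_ge0 ?expR_ge0 //; last first.
    by apply: prodr_ge0 => i _; rewrite mulr_ge0 ?normc_ge0.
  apply: le_trans.
  have -> : (m%:R * s) ^+ m = \prod_(x <- take m xs) (m%:R * s).
    by rewrite big_const_seq count_predT size_takel // iter_mulr_1.
  rewrite big_seq [X in _ <= X]big_seq; apply: ler_prod => x xt.
  rewrite mulr_ge0 ?normc_ge0 //= ler_wpM2l //.
  have [i im <-] := nthP 0 xt; rewrite size_takel // in im.
  rewrite nth_take //.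
  have tr : transitive (fun x y : R[i] => normc y <= normc x).
    by move=> a b c h1 h2; apply: le_trans h2 h1.
  have rf : reflexive (fun x y : R[i] => normc y <= normc x) by move=> a /=.
  apply: (sorted_leq_nth tr rf 0 srt) => //; rewrite inE //.
  exact: leq_ltn_trans jx.
have : (m%:R * s) ^+ m <= (C * expR A) ^+ m.
  apply: le_trans h _.
  rewrite expRM_natl exprMn ler_wpM2r ?exprn_ge0 ?expR_ge0 //.
  by rewrite exprS ler_peMr // exprn_ege1.
by rewrite ler_pXn2r // nnegrE mulr_ge0 ?normc_ge0 ?expR_ge0.
Qed.

(** The first [m] squares are bounded through [eta], the others by comparison
    with the telescoping sum of [1 / k - 1 / (k + 1)]. *)
Lemma sum_sqr_le (R : realFieldType) (u : nat -> R) (eta K : R) (m n : nat) :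
  (0 < m)%N -> 0 <= eta -> 0 <= K ->
  (forall j, (j < n)%N -> 0 <= u j <= eta) ->
  (forall j, (j < n)%N -> j.+1%:R * u j <= K) ->
  \sum_(j < n) u j ^+ 2 <= m%:R * eta ^+ 2 + K ^+ 2 / m%:R.
Proof.
move=> m0 eta0 K0 ueta uK.
have H1 k : (k <= n)%N -> \sum_(j < k) u j ^+ 2 <= k%:R * eta ^+ 2.
  move=> kn; apply: le_trans (_ : \sum_(j < k) eta ^+ 2 <= _).
    apply: ler_sum => j _.
    have /andP[h1 h2] := ueta j (leq_trans (ltn_ord j) kn).
    by rewrite ler_sqr.
  by rewrite sumr_const card_ord mulr_natl.
have K2 : 0 <= K ^+ 2 / m%:R by rewrite divr_ge0 ?ler0n ?exprn_ge0.
case: (leqP n m) => nm.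
  apply: le_trans (H1 n (leqnn _)) _; apply: ler_wpDr => //.
  by rewrite ler_wpM2r ?exprn_ge0 ?ler_nat.
have H2 k : (m + k <= n)%N -> \sum_(j < m + k) u j ^+ 2
    <= m%:R * eta ^+ 2 + K ^+ 2 * (m%:R^-1 - (m + k)%:R^-1).
  elim: k => [|k IH] kn.
    by rewrite addn0 subrr mulr0 addr0 H1 // ltnW.
  rewrite addnS in kn *.
  have mk0 : 0 < (m + k)%:R :> R by rewrite ltr0n addn_gt0 m0.
  have h := uK _ kn; have /andP[h0 _] := ueta _ kn.
  have step : u (m + k)%N ^+ 2
      <= K ^+ 2 * ((m + k)%:R^-1 - (m + k).+1%:R^-1).
    have -> : (m + k)%:R^-1 - (m + k).+1%:R^-1
        = ((m + k)%:R * (m + k).+1%:R)^-1 :> R.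
      rewrite -[(m + k).+1]addn1 natrD; field.
      by rewrite -natr1 in h *; apply/andP; split; apply: lt0r_neq0; lra.
    rewrite ler_pdivlMr ?mulr_gt0 ?ltr0n ?addn_gt0 ?m0 //.
    apply: le_trans (_ : ((m + k).+1%:R * u (m + k)%N) ^+ 2 <= _); last first.
      by rewrite ler_sqr // nnegrE ?mulr_ge0.
    rewrite exprMn [X in _ <= X]mulrC ler_wpM2l ?exprn_ge0 //.
    by rewrite expr2 ler_wpM2r // ler_nat.
  rewrite big_ord_recr /=; apply: le_trans (lerD (IH (ltnW kn)) step) _.
  by rewrite -addrA -mulrDr subrKA lexx.
have := H2 (n - m)%N; rewrite subnKC ?(ltnW nm) // => /(_ (leqnn _)) h.
apply: le_trans h _; rewrite lerD2l ler_wpM2l ?exprn_ge0 // gerDl oppr_le0.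
by rewrite invr_ge0.
Qed.

(** The partial sums have a common Lipschitz constant on a disc, so that the lower
    bound at a point, valid for large [N], excludes zeros in a neighbourhood of it
    for the same [N]; compactness makes [N] uniform on the disc. *)
Lemma near_no_root (R : realType) (a : nat -> R[i]) (C A : R) :
  0 <= A -> (forall k, normc (a k) <= C * (A ^+ k / k`!%:R)) ->
  (forall t : R[i], exists2 d : R, 0 < d &
     \forall N \near \oo, d <= normc (\sum_(k < N) a k * t ^+ k)) ->
  forall rho : R, \forall N \near \oo, forall t, normc t <= rho ->
     \sum_(k < N) a k * t ^+ k != 0.
Proof.
move=> A0 bound nv rho0.
pose rho := Num.max 1 rho0.
have rho1 : 1 <= rho by rewrite le_max lexx.
have C0 : 0 <= C.
  have := bound 0; rewrite expr0 divr1 mulr1.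
  by apply: le_trans; rewrite normc_ge0.
(* Half of 4 * rho bounds the modulus on the square of half-side rho; the other
   half leaves room for a neighbourhood of each of its points. *)
pose r := 4 * rho.
have r1 : 1 <= r by rewrite /r; lra.
(* The factor 2 comes from k * r ^+ k.-1 <= (2 * r) ^+ k. *)
pose K := C * expR (2 * r * A).
have K0 : 0 <= K by rewrite mulr_ge0 ?expR_ge0.
have lip N (s t : R[i]) : normc s <= r -> normc t <= r ->
    normc (\sum_(k < N) a k * s ^+ k - \sum_(k < N) a k * t ^+ k)
    <= normc (s - t) * K.
  move=> sr tr; rewrite -sumrB.
  apply: le_trans (normc_sum _ _ _) _.
  apply: le_trans (_ : normc (s - t) * (C * exp_sum N (2 * r * A)) <= _);
    last first.
    by rewrite !ler_wpM2l ?normc_ge0 // exp_sum_le // !mulr_ge0 //; lra.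
  rewrite /exp_sum !mulr_sumr; apply: ler_sum => k _.
  rewrite -mulrBr normcM subrXX normcM.
  rewrite mulrCA ler_wpM2l ?normc_ge0 //.
  apply: le_trans (_ : C * (A ^+ k / k`!%:R) * (2 * r) ^+ k <= _); last first.
    rewrite [(_ * A) ^+ _]exprMn [_ ^+ k * A ^+ k]mulrC !mulrA.
    by rewrite [X in _ <= X]mulrAC.
  apply: ler_pM => //; rewrite ?normc_ge0 //.
  apply: le_trans (normc_sum _ _ _) _.
  apply: le_trans (_ : \sum_(i < k) r ^+ k <= _).
    apply: ler_sum => i _; rewrite normcM !normcX.
    apply: le_trans (_ : r ^+ (k.-1 - i) * r ^+ i <= _).
      by apply: ler_pM;
        rewrite ?exprn_ge0 ?normc_ge0 // lerXn2r ?nnegrE ?normc_ge0 //; lra.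
    by rewrite -exprD ler_weXn2l //; have := ltn_ord i; lia.
  rewrite sumr_const card_ord -[X in X <= _]mulr_natl [(_ * r) ^+ _]exprMn.
  rewrite ler_wpM2r ?exprn_ge0 //; first lra.
  by rewrite -natrX ler_nat ltnW // ltn_expl.
pose B : set (R * R) := `[- rho, rho] `*` `[- rho, rho].
have cB : compact B by apply: compact_setX; apply: segment_compact.
have /compact_near_coveringP cov := cB.
have loc (z : R * R) : B z -> \forall z' \near z & N \near \oo,
    \sum_(k < N) a k * (z'.1 +i* z'.2) ^+ k != 0.
  move=> [/=]; rewrite !in_itv /= => /andP[x1 x2] /andP[y1 y2].
  have [d d0 Hd] := nv (z.1 +i* z.2).
  pose e := Num.min 1 (d / (2 * (K + 1))).
  have e0 : 0 < e by rewrite lt_min ltr01 divr_gt0 // mulr_gt0 // ltr_wpDl.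
  have zr : normc (z.1 +i* z.2) <= 2 * rho.
    have := normc_le_abs z.1 z.2.
    have : `|z.1| <= rho by rewrite ler_norml x1.
    have : `|z.2| <= rho by rewrite ler_norml y1.
    by lra.
  exists (ball z e,
          [set N | d <= normc (\sum_(k < N) a k * (z.1 +i* z.2) ^+ k)]).
    by split => //; exact: nbhsx_ballx.
  move=> [z' N] [/= [b1 b2] dN].
  have {b1 b2} zz : normc ((z.1 +i* z.2) - (z'.1 +i* z'.2)) < 2 * e.
    apply: le_lt_trans (normc_le_abs (z.1 - z'.1) (z.2 - z'.2)) _.
    by rewrite mulr_natl mulr2n ltrD.
  have e1 : e <= 1 by rewrite ge_min lexx.
  have eK : 2 * e * K < d.
    have : e <= d / (2 * (K + 1)) by rewrite ge_min lexx orbT.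
    rewrite ler_pdivlMr; last by rewrite mulr_gt0 // ltr_wpDl.
    by nra.
  apply/eqP => p0.
  have zr' : normc (z'.1 +i* z'.2) <= r.
    rewrite -[X in normc X](subrK (z.1 +i* z.2)).
    by apply: le_trans (le_normcD _ _) _; rewrite normc_distC /r; lra.
  have zr4 : normc (z.1 +i* z.2) <= r by rewrite /r; lra.
  have := lip N _ _ zr4 zr'; rewrite p0 subr0 => /(le_trans dN).
  rewrite leNgt => /negP; apply; apply: le_lt_trans eK.
  by rewrite ler_wpM2r // ltW.
pose P N (z : R * R) := \sum_(k < N) a k * (z.1 +i* z.2) ^+ k != 0.
have H := cov nat \oo P _ loc.
near=> N => t tr.
have /(_ (complex.Re t, complex.Im t)) : B `<=` P N by near: N; exact: H.
rewrite /P; case: t tr => x y tr /=; apply.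
have : rho0 <= rho by rewrite le_max lexx orbT.
have := normc_ge_abs x y.
rewrite /B /= !in_itv /= => /andP[hx hy] h.
by split; rewrite -ler_norml; apply: le_trans h; apply: le_trans tr.
Unshelve. all: by end_near.
Qed.

(** The coefficient bound is exponential type, and the last hypothesis says that
    the sum of the power series has no zero. *)
Lemma nonvanishing_recurrence (R : realType) (a : nat -> R[i]) (C A : R) :
  a 0 = 1 -> 0 <= A -> (forall k, normc (a k) <= C * (A ^+ k / k`!%:R)) ->
  (forall t : R[i], exists2 d : R, 0 < d &
     \forall N \near \oo, d <= normc (\sum_(k < N) a k * t ^+ k)) ->
  forall k, a k.+1 *+ k.+1 = a 1 * a k.
Proof.
move=> a0 A0 bound nv [|k]; first by rewrite a0 mulr1.
pose K := C * expR A.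
pose B := \sum_(i < k.+1) normc (a i).
have C1 : 1 <= C.
  by have := bound 0; rewrite a0 normc1 expr0 divr1 mulr1.
have B0 : 0 <= B by apply: sumr_ge0 => i _; apply: normc_ge0.
(* A partial sum without zeros in the disc of radius m has \sum_j |x_j| ^ 2 at
   most (1 + K ^ 2) / m, by sum_sqr_le with eta = 1 / m. *)
have key m : (0 < m)%N ->
    m%:R * normc (a k.+2 *+ k.+2 - a 1 * a k.+1) <= (1 + K ^+ 2) * B.
  move=> m0.
  have [N0 _ HN] := near_no_root A0 bound nv m%:R.
  pose N := (N0 + k.+3)%N.
  have {HN} nr t : normc t <= m%:R -> \sum_(k < N) a k * t ^+ k != 0.
    by apply: HN => /=; rewrite /N leq_addr.
  pose p := \poly_(i < N) a i.
  have pi i : (i < k.+3)%N -> p`_i = a i.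
    by move=> ik; rewrite coef_poly (leq_trans ik) // leq_addl.
  have [ys pE yr] := @linprod_factor R[i] p (etrans (pi 0 isT) a0).
  pose xs := sort (fun x y => normc y <= normc x) ys.
  have xsE : p = linprod xs.
    by rewrite pE /linprod; apply/esym/perm_big; rewrite perm_sort.
  have xs_small x : x \in xs -> normc x <= m%:R^-1.
    rewrite mem_sort => /yr [x0 px]; rewrite leNgt; apply/negP => hx.
    have h : normc (- x^-1) <= m%:R.
      rewrite normcN normcV -[leRHS]invrK.
      rewrite lef_pV2 ?ltW // posrE ?invr_gt0 ?ltr0n //.
      by apply: lt_trans hx; rewrite invr_gt0 ltr0n.
    by have := nr _ h; rewrite -horner_poly -/p px eqxx.
  have srt : sorted (fun x y : R[i] => normc y <= normc x) xs.
    by apply: sort_sorted => x y /=; apply: le_total.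
  have bnd i : normc (linprod xs)`_i <= C * (A ^+ i / i`!%:R).
    rewrite -xsE coef_poly; case: ifP => // _.
    rewrite normc0 mulr_ge0 ?divr_ge0 ?exprn_ge0 ?ler0n //.
    exact: le_trans C1.
  have dec j := root_decay (j := j) A0 bnd srt.
  have mi0 : 0 <= m%:R^-1 :> R by rewrite invr_ge0 ler0n.
  have m1 : m%:R^-1 <= 1 :> R by rewrite invf_le1 ?ltr0n // ler1n.
  have sq : \sum_(j < size xs) normc xs`_j ^+ 2
      <= m%:R * m%:R^-1 ^+ 2 + K ^+ 2 / m%:R.
    apply: (sum_sqr_le (u := fun j => normc xs`_j)) => //.
    - by rewrite mulr_ge0 ?expR_ge0 //; apply: le_trans C1.
    - by move=> j jx; rewrite normc_ge0 xs_small // mem_nth.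
  have := @newton_defect R[i] (size xs) (fun i => xs`_i) k.
  have <- : p = \prod_(i < size xs) (1 + xs`_i *: 'X).
    by rewrite xsE /linprod (big_nth 0) big_mkord.
  move=> /= H; rewrite !pi // in H.
  have {H} : normc (a k.+2 *+ k.+2 - a 1 * a k.+1)
      <= (\sum_(j < size xs) normc xs`_j ^+ 2) * B.
    rewrite normc_le; apply: le_trans (H _) _.
      by move=> i; rewrite -normc_le (le_trans _ m1) // xs_small // mem_nth.
    rewrite rmorphM !rmorph_sum /=.
    rewrite le_eqVlt; apply/orP; left; apply/eqP.
    congr (_ * _); apply: eq_bigr => i _; first by rewrite rmorphXn.
    by rewrite pi //; have := ltn_ord i; lia.
  move=> H; have m00 : 0 < m%:R :> R by rewrite ltr0n.
  rewrite -ler_pdivlMl //; apply: le_trans H _.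
  apply: le_trans (ler_wpM2r B0 sq) _.
  rewrite le_eqVlt; apply/orP; left; apply/eqP.
  by field; apply: lt0r_neq0.
apply/eqP; rewrite -subr_eq0 -normc_eq0 eq_le normc_ge0 andbT leNgt; apply/negP.
set e := normc _ in key * => e0.
have E0 : 0 <= (1 + K ^+ 2) * B.
  rewrite mulr_ge0 // addr_ge0 // exprn_ge0 // mulr_ge0 ?expR_ge0 //.
  exact: le_trans C1.
have h := archi_boundP (divr_ge0 E0 (ltW e0)).
set M := Num.Def.archi_bound _ in h.
have M0 : (0 < M)%N.
  by rewrite -(ltr_nat R) (le_lt_trans _ h) // divr_ge0 // ltW.
by have := key M M0; rewrite leNgt -ltr_pdivrMr // h.
Qed.

(** * Linear forms and polarization *)

Local Notation "''X_' i" := (@mpolyX _ _ (mnm1 i))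
  (at level 8, i at level 2, format "''X_' i").

Lemma poly_eq0_of_horner (F : numDomainType) (q : {poly F}) :
  (forall t, q.[t] = 0) -> q = 0.
Proof.
move=> q0; apply/eqP; apply/negPn/negP => qn0.
have := max_poly_roots (rs := [seq i%:R | i <- iota 0 (size q)]) qn0.
rewrite size_map size_iota ltnn => h; suff: false by []; apply: h.
  by apply/allP => x _; apply/rootP.
by rewrite map_inj_uniq ?iota_uniq // => x y /eqP; rewrite eqr_nat => /eqP.
Qed.

(** Replacing [l] by [l + t *: l'] in the hypothesis gives a polynomial in [t]
    that vanishes identically; its coefficient of degree one is a nonzero multiple
    of the value in the conclusion. *)
Lemma polarization_step (F : numFieldType) (A : comAlgType F)
    (theta : {linear A -> F^o}) (P : A -> Prop) (q l' : A) :
  (forall t l m, P l -> P m -> P (l + t *: m)) ->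
  (forall k l, P l -> theta (l ^+ k * q) = 0) -> P l' ->
  forall k l, P l -> theta (l ^+ k * (l' * q)) = 0.
Proof.
move=> Plin Hq Pl' k l Pl.
pose c i : F := theta (l ^+ (k.+1 - i) * l' ^+ i * q) *+ 'C(k.+1, i).
have cE (t : F) : (\poly_(i < k.+2) c i).[t] = 0.
  rewrite horner_poly -[RHS](Hq k.+1 (l + t *: l') (Plin _ _ _ Pl Pl')).
  rewrite exprDn mulr_suml linear_sum; apply: eq_bigr => i _.
  rewrite /c !mulrnAl raddfMn; congr (_ *+ _).
  rewrite exprZn -scalerAr -scalerAl mulrC.
  by apply/esym; exact: (linearZ_LR theta).
have := congr1 (fun p : {poly F} => p`_1) (poly_eq0_of_horner cE).
rewrite coef_poly coef0 /= /c bin1 subn1 expr1 -mulrA => /eqP.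
by rewrite mulrn_eq0 /= => /eqP.
Qed.

Definition linform (R : realType) n (w : 'rV[R[i]]_n) : mpoly n R[i] :=
  \sum_(i < n) w ord0 i *: 'X_i.

Lemma linformD (R : realType) n (t : R[i]) (w w' : 'rV[R[i]]_n) :
  linform (w + t *: w') = linform w + t *: linform w'.
Proof.
rewrite /linform scaler_sumr -big_split; apply: eq_bigr => i _.
by rewrite !mxE scalerDl scalerA.
Qed.

Lemma linformZ (R : realType) n (t : R[i]) (w : 'rV[R[i]]_n) :
  linform (t *: w) = t *: linform w.
Proof.
rewrite -[t *: w]add0r linformD /linform big1 ?add0r // => i _.
by rewrite mxE scale0r.
Qed.

Lemma polyfun_linform (R : realType) n (w z : 'rV[R[i]]_n) :
  polyfun (linform w) z = \sum_(i < n) w ord0 i * z ord0 i.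
Proof.
rewrite /polyfun /linform raddf_sum /=; apply: eq_bigr => i _.
by rewrite mevalZ mevalXU.
Qed.

Lemma functional_eq0_of_linform_powers (R : realType) n
    (theta : {linear mpoly n R[i] -> R[i]^o}) :
  (forall k w, theta (linform w ^+ k) = 0) -> forall p, theta p = 0.
Proof.
move=> h p; pose P (l : mpoly n R[i]) := exists w, l = linform w.
have Plin t l m : P l -> P m -> P (l + t *: m).
  by move=> [w ->] [w' ->]; exists (w + t *: w'); rewrite linformD.
have PX i : P 'X_i.
  exists (delta_mx ord0 i); rewrite /linform (bigD1 i) //= big1.
    by rewrite mxE !eqxx scale1r addr0.
  by move=> j /negbTE ji; rewrite mxE ji scale0r.
suff X m : forall k l, P l -> theta (l ^+ k * mpolyX _ m) = 0.
  rewrite [p]mpolyE linear_sum big1 // => m _.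
  rewrite linearZ_LR -[mpolyX _ m]mul1r -(expr0 (linform 0)) X ?scaler0 //.
  by exists 0.
rewrite mpolyXE_id; elim/big_rec: _ => [k l [w ->]|i q _ IH].
  by rewrite mulr1.
elim: (m i) => [|e IHe]; first by rewrite expr0 mul1r.
by rewrite exprS -mulrA; apply: (polarization_step Plin IHe (PX i)).
Qed.

(** * Exponentials as elements of the function space *)

(** A norm over [R[i]] has its values in [R[i]]; they are real. *)
Definition rnorm (R : realType) (V : normedModType R[i]) (x : V) : R :=
  complex.Re `|x|.

Lemma normr_rnorm (R : realType) (V : normedModType R[i]) (x : V) :
  `|x| = (rnorm x)%:C.
Proof. by rewrite /rnorm RRe_real // normr_real. Qed.

Lemma rnorm_ge0 (R : realType) (V : normedModType R[i]) (x : V) : 0 <= rnorm x.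
Proof. by rewrite -ler0c -normr_rnorm. Qed.

Lemma rnorm_le (R : realType) (V : normedModType R[i]) (x : V) (r : R) :
  (rnorm x <= r) = (`|x| <= r%:C).
Proof. by rewrite normr_rnorm lecR. Qed.

Lemma bounded_operator_ge0 (R : realType) (V W : normedModType R[i])
    (f : V -> W) :
  bounded_operator f ->
  exists2 M : R, 0 <= M & forall x, rnorm (f x) <= M * rnorm x.
Proof.
move=> [M HM]; exists (Num.max 0 M); first by rewrite le_max lexx.
move=> x; rewrite rnorm_le; apply: le_trans (HM x) _.
rewrite normr_rnorm -rmorphM lecR ler_wpM2r ?rnorm_ge0 //.
by rewrite le_max lexx orbT.
Qed.

Lemma bounded_functional_ge0 (R : realType) (V : normedModType R[i])
    (f : V -> R[i]^o) :
  bounded_operator f ->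
  exists2 M : R, 0 <= M & forall x, normc (f x) <= M * rnorm x.
Proof. exact: bounded_operator_ge0. Qed.

Lemma exp_series_cvg (R : realType) (V : completeNormedModType R[i])
    (v : nat -> V) (B M : R) :
  0 <= B -> 0 <= M -> (forall k, rnorm (v k) <= B * M ^+ k) ->
  exists f : V, forall e : R, 0 < e -> \forall N \near \oo,
    rnorm (\sum_(k < N) (k`!%:R^-1 : R[i]) *: v k - f) < e.
Proof.
move=> B0 M0 bound; pose u k := (k`!%:R^-1 : R[i]) *: v k.
have : cauchy (series u @ \oo).
  apply/cauchy_seriesP => _ /posC_real [e e0 ->].
  have B1 : 0 < B + 1 by rewrite ltr_wpDl.
  have cv : cauchy (series (exp_coeff M) @ \oo).
    by apply: cvg_cauchy; exact: is_cvg_series_exp_coeff.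
  move/cauchy_seriesP : cv => /(_ _ (divr_gt0 e0 B1)).
  apply: filterS => -[m n] /= h.
  apply: (@le_lt_trans _ _ ((B * `|\sum_(m <= k < n) exp_coeff M k|)%:C)).
    rewrite ger0_norm; last by apply: sumr_ge0 => k _; exact: exp_coeff_ge0.
    apply: le_trans (ler_norm_sum _ _ _) _.
    rewrite mulr_sumr rmorph_sum; apply: ler_sum => k _.
    rewrite /u normrZ normr_rnorm normfV normr_nat.
    rewrite -(rmorph_nat (real_complex R)) -fmorphV -rmorphM lecR.
    by rewrite mulrC /exp_coeff /= mulrA ler_wpM2r // invr_ge0.
  rewrite ltcR; move: h; rewrite ltr_pdivlMr // => h; apply: le_lt_trans h.
  by rewrite mulrC ler_wpM2l // lerDl.
move/cauchy_cvgP => /cvg_ex [f cf]; exists f => e e0.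
move/cvgrPdist_lt : cf => /(_ e%:C); rewrite ltcR => /(_ e0).
apply: filterS => N.
by rewrite distrC /series /= big_mkord normr_rnorm ltcR.
Qed.

Lemma polynomial_embedding (R : realType) n (D : set 'rV[R[i]]_n)
    (X : completeNormedModType R[i]) (ev : {linear X -> (D -> R[i]^o)}) :
  injective ev -> Q1 ev ->
  exists2 iota : {linear mpoly n R[i] -> X},
    (forall p z, ev (iota p) z = polyfun p (val z)) &
    (forall p f, (forall z, ev f z = polyfun p (val z)) -> f = iota p).
Proof.
move=> ev_inj [/choice [iota iotaE] _].
have uniq p f : (forall z, ev f z = polyfun p (val z)) -> f = iota p.
  by move=> h; apply: ev_inj; apply/funext => z; rewrite h iotaE.
have lin : linear iota.
  move=> c p q; apply/esym/uniq => z; rewrite linearP.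
  by rewrite /polyfun mevalD mevalZ -!/(polyfun _ _) -!iotaE.
pose iL : {linear mpoly n R[i] -> X} :=
  HB.pack_for {linear mpoly n R[i] -> X} iota
    (GRing.isLinear.Build _ _ _ _ iota lin).
by exists iL.
Qed.

(** Multiplication by [linform w] is the combination of the shifts with
    coefficients [w], hence bounded. *)
Lemma linform_powers_bound (R : realType) n (D : set 'rV[R[i]]_n)
    (X : completeNormedModType R[i]) (ev : {linear X -> (D -> R[i]^o)})
    (iota : {linear mpoly n R[i] -> X}) :
  injective ev -> Q3 ev ->
  (forall p z, ev (iota p) z = polyfun p (val z)) ->
  forall w, exists2 M : R, 0 <= M &
    forall k, rnorm (iota (linform w ^+ k)) <= rnorm (iota 1) * M ^+ k.
Proof.
move=> ev_inj hQ3 iotaE w.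
have [S HS] := choice hQ3.
have /choice [m Hm] : forall i, exists m : R,
    0 <= m /\ forall x, rnorm (S i x) <= m * rnorm x.
  by move=> i; have [/bounded_operator_ge0 [m m0 Hm] _] := HS i; exists m.
have SE i p : iota ('X_i * p) = S i (iota p).
  apply: ev_inj; apply/funext => z; have [_ ->] := HS i.
  by rewrite !iotaE /polyfun mevalM mevalXU.
have M0 : 0 <= \sum_(i < n) normc (w ord0 i) * m i.
  by apply: sumr_ge0 => i _; rewrite mulr_ge0 ?normc_ge0 //; have [] := Hm i.
exists (\sum_(i < n) normc (w ord0 i) * m i) => //.
elim=> [|k IH]; first by rewrite !expr0 mulr1.
rewrite !exprS {1}/linform mulr_suml linear_sum /= rnorm_le.
apply: le_trans (ler_norm_sum _ _ _) _.
apply: (@le_trans _ _ ((\sum_(i < n) normc (w ord0 i) * m i)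
                       * rnorm (iota (linform w ^+ k)))%:C).
  rewrite mulr_suml rmorph_sum; apply: ler_sum => i _.
  rewrite -scalerAl linearZ normrZ SE normr_normc normr_rnorm -rmorphM lecR.
  by rewrite -mulrA ler_wpM2l ?normc_ge0 //; have [] := Hm i.
by rewrite lecR mulrCA ler_wpM2l.
Qed.

Lemma exp_vector (R : realType) n (D : set 'rV[R[i]]_n)
    (X : completeNormedModType R[i]) (ev : {linear X -> (D -> R[i]^o)})
    (iota : {linear mpoly n R[i] -> X}) :
  injective ev -> Q2 ev -> Q3 ev ->
  (forall p z, ev (iota p) z = polyfun p (val z)) ->
  forall w, exists2 f : X,
    (forall z, ev f z = expfun w (val z)) &
    forall e : R, 0 < e -> \forall N \near \oo,
      rnorm (\sum_(k < N) (k`!%:R^-1 : R[i]) *: iota (linform w ^+ k) - f) < e.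
Proof.
move=> ev_inj [evb _] hQ3 iotaE w.
have [M M0 HM] := linform_powers_bound ev_inj hQ3 iotaE w.
have [f Hf] := exp_series_cvg (rnorm_ge0 _) M0 HM.
exists f => // z; have [K K0 HK] := bounded_functional_ge0 (evb z).
apply/eqP; rewrite -subr_eq0; apply/eqP.
apply: (@eq0_of_normc_le _ _ (K + 1)); first by rewrite addr_ge0.
move=> e e0; pose s := \sum_(i < n) w ord0 i * val z ord0 i.
have /cvgrPdist_lt /(_ e e0) h1 := @exp_sum_cvg_cexp R s.
have : \forall N \near \oo,
    normc (ev f z - expfun w (val z)) <= (K + 1) * e.
  apply: filterS2 (Hf e e0) h1 => N; set u := \sum_(k < N) _ => h2.
  rewrite sub0r normrN ger0_norm ?normc_ge0 // => h1.
  have evs : ev u z = exp_sum N s.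
    rewrite /u linear_sum fct_sumE /exp_sum; apply: eq_bigr => k _.
    rewrite linearZ /= -[LHS]/(_ * ev (iota _) z) iotaE /polyfun rmorphXn /=.
    by rewrite -/(polyfun _ _) polyfun_linform mulrC.
  rewrite -(subrKA (exp_sum N s)) mulrDl mul1r.
  apply: le_trans (le_normcD _ _) _; apply: lerD; last exact: ltW.
  rewrite normc_distC -evs (_ : _ - _ = ev (u - f) z).
    by apply: le_trans (HK _) _; rewrite ler_wpM2l // ltW.
  by rewrite linearB.
by move=> [N _ /(_ N)]; apply => /=.
Qed.

(** * Identification of the functional *)

(** The coefficients [m k] below are those of [t |-> L (exp (t w . z)) / L 1]. *)
Lemma linform_moments (R : realType) n (D : set 'rV[R[i]]_n)
    (X : completeNormedModType R[i]) (ev : {linear X -> (D -> R[i]^o)})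
    (iota : {linear mpoly n R[i] -> X}) (L : {linear X -> R[i]^o})
    (a := L (iota 1) : R[i]) :
  injective ev -> Q2 ev -> Q3 ev ->
  (forall p z, ev (iota p) z = polyfun p (val z)) ->
  bounded_operator L ->
  (forall w f, (forall z : D, ev f z = expfun w (val z)) -> L f <> 0) ->
  a != 0 ->
  forall w k, L (iota (linform w ^+ k)) = a * (L (iota (linform w)) / a) ^+ k.
Proof.
move=> ev_inj hQ2 hQ3 iotaE hL hexp a0 w k.
have [K K0 HK] := bounded_functional_ge0 hL.
pose m k : R[i] := L (iota (linform w ^+ k)) / (k`!%:R * a).
have fact0 j : j`!%:R != 0 :> R[i] by rewrite pnatr_eq0 -lt0n fact_gt0.
have [M M0 HM] := linform_powers_bound ev_inj hQ3 iotaE w.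
have a1 : 0 < normc a by rewrite lt_def normc_ge0 normc_eq0 a0.
have rec : forall k, m k.+1 *+ k.+1 = m 1 * m k.
  apply: (@nonvanishing_recurrence R m (K * rnorm (iota 1) / normc a) M _ M0)
    => [|j|t].
  - by rewrite /m expr0 mul1r divff.
  - rewrite /m normcM normcV.
    rewrite normcM -(rmorph_nat (real_complex R)) normc_real normr_nat.
    have f0 : 0 < j`!%:R :> R by rewrite ltr0n fact_gt0.
    rewrite ler_pdivrMr ?mulr_gt0 //.
    apply: le_trans (HK _) _; apply: le_trans (ler_wpM2l K0 (HM j)) _.
    rewrite le_eqVlt; apply/orP; left; apply/eqP.
    by field; rewrite !lt0r_neq0.
  - have [f fE fcv] := exp_vector ev_inj hQ2 hQ3 iotaE (t *: w).
    have Lf0 : 0 < normc (L f).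
      by rewrite lt_def normc_ge0 normc_eq0 andbT; apply/eqP; apply: hexp fE.
    exists (normc (L f) / 2 / normc a); first by rewrite !divr_gt0.
    have K1 : 0 < 2 * (K + 1) by rewrite mulr_gt0 // ltr_wpDl.
    apply: filterS (fcv _ (divr_gt0 Lf0 K1)) => N.
    set u := \sum_(_ < _) _ => uf.
    have -> : \sum_(k < N) m k * t ^+ k = L u / a.
      rewrite /u !linear_sum mulr_suml; apply: eq_bigr => j _.
      have LZ (c : R[i]) x : L (c *: x) = c * L x := linearZ_LR L c x.
      have iZ (c : R[i]) p : iota (c *: p) = c *: iota p :=
        linearZ_LR iota c p.
      rewrite LZ linformZ exprZn iZ LZ /m.
      by field; rewrite a0 fact0.
    rewrite normcM normcV ler_wpM2r ?invr_ge0 ?(ltW a1) //.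
    have : normc (L f) <= normc (L u) + K * rnorm (u - f).
      rewrite -[in leLHS](subrK (L u) (L f)) addrC.
      apply: le_trans (le_normcD _ _) _; rewrite lerD2l normc_distC.
      by apply: le_trans (HK _); rewrite linearB.
    have : K * rnorm (u - f) <= normc (L f) / 2.
      move: uf; rewrite ltr_pdivlMr // => uf.
      by have := rnorm_ge0 (u - f); nra.
    by lra.
have mE j : L (iota (linform w ^+ j)) = m j * (j`!%:R * a).
  by rewrite /m divfK // mulf_neq0.
have m1 : L (iota (linform w)) / a = m 1 by rewrite /m expr1 mul1r.
elim: k => [|k IH]; first by rewrite !expr0 mulr1.
rewrite [(_ / a) ^+ _]exprS mulrCA -IH m1 !mE factS natrM.
by rewrite -[_.+1%:R * _ * a]mulrA mulrA mulr_natr rec -mulrA.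
Qed.

Lemma functional_eq_of_eq_polynomials (R : realType) n (D : set 'rV[R[i]]_n)
    (X : completeNormedModType R[i]) (ev : {linear X -> (D -> R[i]^o)})
    (L : {linear X -> R[i]^o}) (a : R[i]) (b : D) :
  Q1 ev -> Q2 ev -> bounded_operator L ->
  (forall p g, (forall z, ev g z = polyfun p (val z)) -> L g = a * ev g b) ->
  forall f : X, L f = a * ev f b.
Proof.
move=> [_ dns] [/(_ b) /bounded_functional_ge0 [K' K'0 HK'] _].
move=> /bounded_functional_ge0 [K K0 HK] Lpoly f.
apply/eqP; rewrite -subr_eq0; apply/eqP.
apply: (@eq0_of_normc_le _ _ (K + normc a * K')).
  by rewrite addr_ge0 ?mulr_ge0 ?normc_ge0.
move=> e e0; case: (dns (ball f e%:C)^°).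
- by exists f; apply: nbhsx_ballx; rewrite ltcR.
- exact: open_interior.
move=> g [/interior_subset + [p gE]].
rewrite -ball_normE /= normr_rnorm ltcR => fg.
have -> : L f - a * ev f b = L (f - g) - a * ev (f - g) b.
  rewrite !linearB /= (Lpoly p g gE) -[(ev f - ev g) b]/(ev f b - ev g b).
  by ring.
apply: le_trans (le_normcD _ _) _; rewrite normcN mulrDl; apply: lerD.
  by apply: le_trans (HK _) _; rewrite ler_wpM2l // ltW.
rewrite normcM -mulrA ler_wpM2l ?normc_ge0 //.
by apply: le_trans (HK' _) _; rewrite ler_wpM2l // ltW.
Qed.

Theorem theorem3p5 (R : realType) (n : nat) (D : set 'rV[R[i]]_n)
    (X : completeNormedModType R[i]) (ev : {linear X -> (D -> R[i]^o)})
    (ev_inj : injective ev)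
    (hQ1 : Q1 ev) (hQ2 : Q2 ev) (hQ3 : Q3 ev)
    (L : {linear X -> R[i]^o}) (hL : bounded_operator L)
    (hexp : forall (w : 'rV[R[i]]_n) (f : X),
       (forall z : D, ev f z = expfun w (val z)) -> L f <> 0) :
  exists (a : R[i]) (b : D), a <> 0 /\ forall f : X, L f = a * ev f b.
Proof.
have [iota iotaE iota_uniq] := polynomial_embedding ev_inj hQ1.
have [K K0 HK] := bounded_functional_ge0 hL.
pose a : R[i] := L (iota 1).
have a0 : a != 0.
  (* The constant function 1 is the exponential for w = 0. *)
  apply/eqP; apply: (hexp 0) => z; rewrite iotaE /polyfun meval1 /expfun big1.
    by rewrite /cexp /= expR0 cos0 sin0 mulr1 mulr0.
  by move=> i _; rewrite mxE mul0r.
have moments := linform_moments ev_inj hQ2 hQ3 iotaE hL hexp a0.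
pose b : 'rV[R[i]]_n := \row_i (L (iota 'X_i) / a).
have Lb w : L (iota (linform w)) / a = polyfun (linform w) b.
  rewrite polyfun_linform /linform !linear_sum mulr_suml.
  by apply: eq_bigr => i _; rewrite mxE !linearZ_LR /= mulrA.
have Lpoly p : L (iota p) = a * polyfun p b.
  pose theta p : R[i]^o := L (iota p) - a * polyfun p b.
  have lin : linear theta.
    move=> c p1 p2; rewrite /theta /polyfun mevalD mevalZ !linearP /=.
    by rewrite -![_ *: _]/(_ * _); ring.
  pose thetaL : {linear mpoly n R[i] -> R[i]^o} :=
    HB.pack_for {linear mpoly n R[i] -> R[i]^o} theta
      (GRing.isLinear.Build _ _ _ _ theta lin).
  apply/eqP; rewrite -subr_eq0; apply/eqP.
  apply: (functional_eq0_of_linform_powers (theta := thetaL)) => k w.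
  rewrite /= /theta moments Lb /polyfun rmorphXn /=.
  by apply: subrr.
have Db : D b.
  (* The bounded extension of p |-> p b required by Q2 is L / a. *)
  case: hQ2 => _; apply.
  pose La (f : X) : R[i]^o := a^-1 *: (L f : R[i]^o).
  have lin : linear La.
    by move=> c f g; rewrite /La linearP scalerDr !scalerA mulrC.
  exists (HB.pack_for {linear X -> R[i]^o} La
           (GRing.isLinear.Build _ _ _ _ La lin)).
  split.
    exists (normc a^-1 * K) => x /=.
    rewrite /La normrZ rmorphM -mulrA ler_wpM2l //.
    by have := HK x; rewrite normc_le normr_rnorm -rmorphM.
  move=> p f /iota_uniq -> /=.
  by rewrite /La Lpoly -[_ *: _]/(_ * _) mulrA mulVf // mul1r.
exists a, (exist _ b (mem_set Db)); split; first exact/eqP.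
apply: functional_eq_of_eq_polynomials hQ1 hQ2 hL _ => p g gE.
by rewrite gE (iota_uniq p g gE) Lpoly.
Qed.
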